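(* Let the OWA weights be nonincreasing, i.e. $w_1\ge w_2\ge\dots\ge w_K$. For each element $e_i\in E$ let $\hat c_{i1}\ge\hat c_{i2}\ge\dots\ge\hat c_{iK}$ be the costs $c_{i1},\dots,c_{iK}$ in nonincreasing order, let $\hat c_i=\sum_{j=1}^Kw_j\hat c_{ij}$, and let $\hat X\in\Phi$ be a solution minimizing $\hat C(X)=\sum_{e_i\in X}\hat c_i$ over $X\in\Phi$. Then $$\mathrm{OWA}(\hat X)\le w_1K\cdot\mathrm{OWA}(X)\quad\text{for any }X\in\Phi,$$ and the bound is tight: for any number of scenarios $K$ and any nonincreasing weights $w_1,\dots,w_K$ there are an instance $(E,\Phi,\Gamma)$, a minimizer $\hat X$ of $\hat C$ over $\Phi$, and an $X\in\Phi$ such that $\mathrm{OWA}(X)>0$ and $\mathrm{OWA}(\hat X)=w_1K\cdot\mathrm{OWA}(X)$.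
   Context: $E=\{e_1,\dots,e_n\}$ is a finite set of elements, $\Phi\subseteq2^E$ is a (nonempty) set of feasible solutions, and $\Gamma=\{\pmb{c}_1,\dots,\pmb{c}_K\}$ is a scenario set of $K$ distinct cost scenarios $\pmb{c}_j=(c_{1j},\dots,c_{nj})$ with nonnegative entries. For $X\in\Phi$, $F(X,\pmb{c}_j)=\sum_{e_i\in X}c_{ij}$. For a weight vector $\pmb{w}=(w_1,\dots,w_K)$ with $w_j\in[0,1]$ and $\sum_jw_j=1$, $$\mathrm{OWA}(X)=\sum_{j=1}^Kw_jF(X,\pmb{c}_{\sigma(j)}),$$ where $\sigma$ is a permutation of $\{1,\dots,K\}$ with $F(X,\pmb{c}_{\sigma(1)})\ge\dots\ge F(X,\pmb{c}_{\sigma(K)})$. *)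

(* Defs.v *)
From HB Require Import structures.
From mathcomp Require Import all_boot all_order all_algebra all_fingroup.

Set Implicit Arguments.
Unset Strict Implicit.
Unset Printing Implicit Defensive.

Import Order.TTheory GRing.Theory Num.Theory.

Local Open Scope ring_scope.

Section Sorting.
Variables (R : realFieldType) (K : nat).
Implicit Types (v : 'I_K -> R) (s : 'S_K).

Definition nonincreasing_vec v : Prop :=
  forall j k : 'I_K, (j <= k)%N -> v k <= v j.

Definition sorts_desc v s : bool :=
  [forall j : 'I_K, forall k : 'I_K, (j <= k)%N ==> (v (s k) <= v (s j))].

Lemma sorts_descP v s :
  reflect (nonincreasing_vec (v \o s)) (sorts_desc v s).
Proof.
apply: (iffP forallP) => [H j k jk|H j].
  by have /forallP/(_ k)/implyP/(_ jk) := H j.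
by apply/forallP => k; apply/implyP => jk; exact: H.
Qed.

Lemma sorts_desc_exists v : exists s, sorts_desc v s.
Proof.
have ge_trans : transitive (>=%O : rel R) by move=> y x z xy yz; exact: le_trans yz xy.
have [s Es] : exists s : 'S_K,
    sort >=%O (mktuple v) = [tuple tnth (mktuple v) (s i) | i < K].
  by apply/tuple_permP; rewrite perm_sort.
exists s; apply/sorts_descP => j k jk /=.
have := sort_sorted (fun x y : R => le_total y x) (mktuple v).
move=> /(sorted_leq_nth ge_trans (fun x => lexx x) 0)/(_ j k).
by rewrite !inE Es size_tuple !ltn_ord -!tnth_nth !tnth_mktuple; exact.
Qed.

Definition desc_perm v : 'S_K := xchoose (sorts_desc_exists v).

Lemma desc_permP v : nonincreasing_vec (v \o desc_perm v).
Proof. exact/sorts_descP/(xchooseP (sorts_desc_exists v)). Qed.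

Definition desc v : 'I_K -> R := v \o desc_perm v.

(* In the presence of ties the sorting permutation is not unique, but the
   rearrangement does not depend on it. *)
Lemma descE v s : nonincreasing_vec (v \o s) -> desc v =1 v \o s.
Proof.
move=> vs_noninc j.
have ge_trans : transitive (>=%O : rel R) by move=> y x z xy yz; exact: le_trans yz xy.
have sortedP (t : 'S_K) : nonincreasing_vec (v \o t) ->
    sorted >=%O [tuple (v \o t) i | i < K].
  move=> tP; apply: pairwise_sorted.
  apply/(pairwiseP 0) => a b; rewrite !inE size_tuple => aK bK ab.
  have := tP (Ordinal aK) (Ordinal bK) (ltnW ab).
  have -> : (v \o t) (Ordinal aK) = [tuple (v \o t) i | i < K]`_a.
    by rewrite -[a]/(val (Ordinal aK)) -tnth_nth tnth_mktuple.
  have -> // : (v \o t) (Ordinal bK) = [tuple (v \o t) i | i < K]`_b.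
  by rewrite -[b]/(val (Ordinal bK)) -tnth_nth tnth_mktuple.
have permP (t : 'S_K) : perm_eq [tuple (v \o t) i | i < K] [tuple v i | i < K].
  by apply/tuple_permP; exists t; congr tval; apply: eq_mktuple => i;
     rewrite tnth_mktuple.
suff Et : [tuple desc v i | i < K] = [tuple (v \o s) i | i < K].
  by have := congr1 (fun t => tnth t j) Et; rewrite !tnth_mktuple.
apply/val_inj/(sorted_eq ge_trans).
- by move=> x y /andP[yx xy]; apply/le_anti/andP; split.
- exact/sortedP/desc_permP.
- exact: sortedP.
by rewrite (perm_trans (permP _)) // perm_sym permP.
Qed.

End Sorting.

Section OWA.
Variables (R : realFieldType) (K : nat).

Definition owa_weights (w : 'I_K -> R) : Prop :=
  (forall j, 0 <= w j <= 1) /\ \sum_(j < K) w j = 1.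

Variable E : finType.

(* [c j e] is the cost of element [e] under scenario [j]; injectivity of [c]
   says that the K scenarios are pairwise distinct. *)
Definition owa_instance (Phi : {set {set E}}) (c : 'I_K -> {ffun E -> R})
    : Prop :=
  [/\ Phi != set0, injective c & forall j e, 0 <= c j e].

Definition solution_cost (X : {set E}) (cj : {ffun E -> R}) : R :=
  \sum_(e in X) cj e.

Definition OWA (w : 'I_K -> R) (c : 'I_K -> {ffun E -> R}) (X : {set E}) : R :=
  \sum_(j < K) w j * desc (fun k => solution_cost X (c k)) j.

Definition element_owa (w : 'I_K -> R) (c : 'I_K -> {ffun E -> R}) (e : E) : R :=
  \sum_(j < K) w j * desc (fun k => c k e) j.

Definition aggregated_cost (w : 'I_K -> R) (c : 'I_K -> {ffun E -> R})
    (X : {set E}) : R :=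
  \sum_(e in X) element_owa w c e.

Definition minimizes_over (Phi : {set {set E}}) (f : {set E} -> R)
    (Xhat : {set E}) : Prop :=
  Xhat \in Phi /\ forall X, X \in Phi -> f Xhat <= f X.

End OWA.

(* Main.v *)
(* Exchanging the two sums in [OWA] and applying the rearrangement inequality
   element by element gives [OWA X <= Chat X].  Bounding every weight by [w_1]
   gives [Chat X <= w_1 * \sum_j F(X, c_j)], and by Chebyshev's sum inequality
   [\sum_j F(X, c_j) <= K * OWA X].  Chaining these through the minimality of
   [Xhat] proves the bound.
   For tightness, let [X] consist of [K] elements, the [i]-th one having cost 1
   under scenario [i] only, and let [Xhat] be a single element of cost [K] under
   the first scenario only.  Then [Chat X = Chat Xhat = OWA Xhat = w_1 * K],
   whereas [F(X, c_j) = 1] for all [j], so that [OWA X = 1]. *)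
Require Import Defs.
From HB Require Import structures.
From mathcomp Require Import all_boot all_order all_algebra all_fingroup.

Set Implicit Arguments.
Unset Strict Implicit.
Unset Printing Implicit Defensive.

Import Order.TTheory GRing.Theory Num.Theory.

Local Open Scope ring_scope.

(** * Rearrangement and Chebyshev inequalities for nonincreasing vectors *)

Section NonincreasingVectors.
Variables (R : realFieldType) (K : nat).
Implicit Types (u v w : 'I_K -> R) (t : 'S_K) (i j k m : 'I_K).

Lemma sum_prefix_perm_le u t m : nonincreasing_vec u ->
  \sum_(j < K | (j <= m)%N) u (t j) <= \sum_(j < K | (j <= m)%N) u j.
Proof.
move=> u_noninc.
(* Subtracting [u m] makes [u] nonnegative on the prefix and nonpositive off
   it, so that the prefix maximizes the sum over all index sets. *)
suff : \sum_(j < K | (j <= m)%N) (u (t j) - u m)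
       <= \sum_(j < K | (j <= m)%N) (u j - u m).
  by rewrite !sumrB lerD2r.
rewrite [leRHS]big_mkcond (reindex_inj (@perm_inj _ t^-1%g)).
rewrite [leLHS]big_mkcond /=.
apply: ler_sum => j _; rewrite permKV.
have [jm|mj] := leqP j m.
  by case: ifP => // _; rewrite subr_ge0 u_noninc.
by case: ifP => // _; rewrite subr_le0 u_noninc // ltnW.
Qed.

(** Abel summation: [w] is a nonnegative combination of indicators of prefixes, which reduces
    inequalities linear in [w] to inequalities between prefix sums. *)
Lemma nonneg_nonincreasing_decomp w :
    nonincreasing_vec w -> (forall j, 0 <= w j) ->
  exists2 d : 'I_K -> R, (forall m, 0 <= d m)
    & forall j, w j = \sum_(m < K | (j <= m)%N) d m.
Proof.
(* [W] continues [w] by 0 past the last index, so the last difference is the last weight itself and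
   the telescoping sum ends at 0. *)
move=> w_noninc w_ge0; pose W (n : nat) := oapp w 0 (insub n : option 'I_K).
have WE (j : 'I_K) : W j = w j by rewrite /W valK.
exists (fun m : 'I_K => W m - W m.+1) => [m|j].
  rewrite subr_ge0 WE {1}/W; case: insubP => [k _ Ek|_] /=; last exact: w_ge0.
  by apply: w_noninc; rewrite Ek.
rewrite -(big_mkord (fun m : nat => j <= m)%N (fun m : nat => W m - W m.+1)).
rewrite -(big_nat_widenl _ _ _ predT) // -[LHS]WE.
under eq_bigr do rewrite -opprB.
rewrite sumrN telescope_sumr ?opprB; last exact: ltnW.
by rewrite [W K]/W insubN ?ltnn ?subr0.
Qed.

Lemma rearrangement_le w u t :
    nonincreasing_vec w -> (forall j, 0 <= w j) -> nonincreasing_vec u ->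
  \sum_(j < K) w j * u (t j) <= \sum_(j < K) w j * u j.
Proof.
move=> w_noninc w_ge0 u_noninc.
have [d d_ge0 wE] := nonneg_nonincreasing_decomp w_noninc w_ge0.
have byparts f : \sum_(j < K) w j * f j
    = \sum_(m < K) d m * \sum_(j < K | (j <= m)%N) f j.
  under eq_bigr => j _ do rewrite wE mulr_suml.
  rewrite (exchange_big_dep predT) //=.
  by apply: eq_bigr => m _; rewrite mulr_sumr.
rewrite (byparts (u \o t)) byparts; apply: ler_sum => m _.
exact/ler_wpM2l/sum_prefix_perm_le.
Qed.

Lemma sum_desc v : \sum_(j < K) desc v j = \sum_(j < K) v j.
Proof. by rewrite [RHS](reindex_inj (@perm_inj _ (desc_perm v))). Qed.

(** [v \o t] is itself a rearrangement of [desc v], by [t] followed by the inverse of the sorting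
    permutation. *)
Lemma sum_perm_le_desc w v t :
    nonincreasing_vec w -> (forall j, 0 <= w j) ->
  \sum_(j < K) w j * v (t j) <= \sum_(j < K) w j * desc v j.
Proof.
move=> w_noninc w_ge0.
have := rearrangement_le (t * (desc_perm v)^-1)%g w_noninc w_ge0 (desc_permP v).
by under eq_bigr => j _ do rewrite /= permM permKV.
Qed.

(** The double sum of [(w i - w j) * (u i - u j)] has nonnegative terms, as both vectors decrease
    together, and equals twice the difference of the two sides. *)
Lemma chebyshev_sum_le w u : nonincreasing_vec w -> nonincreasing_vec u ->
  (\sum_(j < K) w j) * (\sum_(j < K) u j) <= K%:R * \sum_(j < K) w j * u j.
Proof.
move=> w_noninc u_noninc.
have : 0 <= \sum_(i < K) \sum_(j < K) (w i - w j) * (u i - u j).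
  apply: sumr_ge0 => i _; apply: sumr_ge0 => j _.
  have [ij|/ltnW ji] := leqP i j.
    by rewrite mulr_ge0 // subr_ge0 ?w_noninc ?u_noninc.
  by rewrite mulr_le0 // subr_le0 ?w_noninc ?u_noninc.
have -> : \sum_(i < K) \sum_(j < K) (w i - w j) * (u i - u j)
    = (K%:R * (\sum_(j < K) w j * u j)
        - (\sum_(j < K) w j) * (\sum_(j < K) u j)) *+ 2.
  have rowE i : \sum_(j < K) (w i - w j) * (u i - u j)
      = (w i * u i *+ K + \sum_(j < K) w j * u j)
        - (w i * (\sum_(j < K) u j) + (\sum_(j < K) w j) * u i).
    (* Writing the multiple by [K] as a constant sum over [j] allows a termwise comparison. *)
    rewrite -[X in _ *+ X](card_ord K) -sumr_const mulr_sumr mulr_suml.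
    rewrite -!big_split -sumrB.
    by apply: eq_bigr => j _;
       rewrite mulrBl !mulrBr opprB addrACA opprD [- _ + _]addrC.
  rewrite (eq_bigr _ (fun i _ => rowE i)) sumrB !big_split /=.
  rewrite sumrMnl sumr_const card_ord -mulr_suml -mulr_sumr.
  by rewrite -!mulr2n -mulrnBl mulr_natl.
by rewrite pmulrn_lge0 // subr_ge0.
Qed.

Lemma weighted_desc_delta (hK : (0 < K)%N) w v (a : R) i :
    0 <= a -> v =1 (fun k => a * (k == i)%:R) ->
  \sum_(j < K) w j * desc v j = w (Ordinal hK) * a.
Proof.
move=> a_ge0 vE; set o := Ordinal hK.
have vtE k : v (tperm o i k) = a * (k == o)%:R.
  by rewrite vE -{2}(tpermL o i) (inj_eq perm_inj).
(* Swapping [i] with the first index sorts [v]; by [descE], this determines [desc v] whichever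
   permutation [desc_perm] picks. *)
have dE j : desc v j = a * (j == o)%:R.
  rewrite (@descE _ _ _ (tperm o i)) /= ?vtE // => k l kl /=.
  rewrite !vtE ler_wpM2l // ler_nat; case: (eqVneq l o) => // El.
  by rewrite -val_eqE /= -leqn0 (leq_trans kl) ?El.
rewrite (bigD1 o) //= dE eqxx mulr1 big1 ?addr0 // => j /negPf jo.
by rewrite dE jo !mulr0.
Qed.

End NonincreasingVectors.

(** * The three inequalities chained in the upper bound *)

Section Bounds.
Variables (R : realFieldType) (K : nat) (E : finType).
Variables (w : 'I_K -> R) (c : 'I_K -> {ffun E -> R}).
Hypotheses (hw : owa_weights w) (w_noninc : nonincreasing_vec w).
Implicit Type X : {set E}.

(** The permutation sorting the total costs of [X] acts on every element's costs, where it cannot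
    beat that element's own descending order. *)
Lemma OWA_le_aggregated_cost X : OWA w c X <= aggregated_cost w c X.
Proof.
have w_ge0 j : 0 <= w j by case/andP: (hw.1 j).
rewrite /OWA /aggregated_cost.
under eq_bigr => j _ do rewrite /desc /= /solution_cost mulr_sumr.
rewrite exchange_big /=; apply: ler_sum => e _.
exact: (sum_perm_le_desc (fun k => c k e)).
Qed.

Lemma aggregated_cost_le (hK : (0 < K)%N) X : (forall j e, 0 <= c j e) ->
  aggregated_cost w c X
    <= w (Ordinal hK) * \sum_(j < K) solution_cost X (c j).
Proof.
move=> c_ge0; rewrite [X in _ * X]exchange_big mulr_sumr /=.
apply: ler_sum => e _; rewrite -(sum_desc (fun k => c k e)) mulr_sumr.
by apply: ler_sum => j _; rewrite ler_wpM2r ?w_noninc //; exact: c_ge0.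
Qed.

Lemma sum_cost_le_OWA X :
  \sum_(j < K) solution_cost X (c j) <= K%:R * OWA w c X.
Proof.
pose F k := solution_cost X (c k).
rewrite -(sum_desc F) -[leLHS]mul1r -[X in X * _ <= _]hw.2.
exact: (chebyshev_sum_le w_noninc (desc_permP F)).
Qed.

End Bounds.

(** * The instance attaining the bound *)

Section TightInstance.
Variables (R : realFieldType) (K : nat) (hK : (0 < K)%N).

(* [Some i] is the [i]-th element of [X], and [None] the element of [Xhat]. *)
Definition tight_cost (j : 'I_K) : {ffun option 'I_K -> R} :=
  [ffun e => if e is Some i then (j == i)%:R
             else K%:R * (j == Ordinal hK)%:R].

Definition tight_opt : {set option 'I_K} := Some @: [set: 'I_K].

Lemma tight_cost_inj : injective tight_cost.
Proof.
move=> j k /ffunP/(_ (Some j)); rewrite !ffunE eqxx.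
by case: eqVneq => // _ /eqP; rewrite oner_eq0.
Qed.

Lemma tight_cost_ge0 j e : 0 <= tight_cost j e.
Proof. by rewrite ffunE; case: e => [i|]; rewrite ?mulr_ge0 ?ler0n. Qed.

Lemma sum_tight_opt (f : option 'I_K -> R) :
  \sum_(e in tight_opt) f e = \sum_(i < K) f (Some i).
Proof.
by rewrite big_imset /= => [|i j _ _ [//]]; apply: eq_bigl => i; rewrite inE.
Qed.

(** Exactly one element of [tight_opt] has cost 1 in each scenario, so sorting has no effect and the
    total weight remains. *)
Lemma OWA_tight_opt w : owa_weights w -> OWA w tight_cost tight_opt = 1.
Proof.
move=> hw; rewrite -[RHS]hw.2; apply: eq_bigr => j _.
rewrite /desc /= /solution_cost sum_tight_opt; set k := desc_perm _ j.
rewrite (bigD1 k) //= ffunE eqxx big1 ?addr0 ?mulr1 // => i.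
by rewrite ffunE eq_sym => /negPf->.
Qed.

Lemma aggregated_tight_opt w :
  aggregated_cost w tight_cost tight_opt = w (Ordinal hK) * K%:R.
Proof.
rewrite /aggregated_cost sum_tight_opt.
under eq_bigr => i _.
  rewrite /element_owa (@weighted_desc_delta _ _ hK _ _ 1 i) //; last first.
    by move=> k; rewrite ffunE mul1r.
  over.
by rewrite sumr_const card_ord mulr1 mulr_natr.
Qed.

Lemma aggregated_tight_hat w :
  aggregated_cost w tight_cost [set None] = w (Ordinal hK) * K%:R.
Proof.
rewrite /aggregated_cost big_set1.
apply: (@weighted_desc_delta _ _ hK _ _ _ (Ordinal hK)) => //.
by move=> k; rewrite ffunE.
Qed.

Lemma OWA_tight_hat w : OWA w tight_cost [set None] = w (Ordinal hK) * K%:R.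
Proof.
apply: (@weighted_desc_delta _ _ hK _ _ _ (Ordinal hK)) => // k.
by rewrite /solution_cost big_set1 ffunE.
Qed.

End TightInstance.

Theorem theorem4 (R : realFieldType) (K : nat) (hK : (0 < K)%N)
    (w : 'I_K -> R) (hw : owa_weights w) (hw_noninc : nonincreasing_vec w) :
  (forall (E : finType) (Phi : {set {set E}}) (c : 'I_K -> {ffun E -> R})
      (Xhat : {set E}),
    owa_instance Phi c ->
    minimizes_over Phi (aggregated_cost w c) Xhat ->
    forall X : {set E}, X \in Phi ->
      OWA w c Xhat <= w (Ordinal hK) * K%:R * OWA w c X)
  /\
  (exists (E : finType) (Phi : {set {set E}}) (c : 'I_K -> {ffun E -> R})
      (Xhat X : {set E}),
    [/\ owa_instance Phi c,
        minimizes_over Phi (aggregated_cost w c) Xhat,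
        X \in Phi,
        0 < OWA w c X
      & OWA w c Xhat = w (Ordinal hK) * K%:R * OWA w c X]).

Proof.
split=> [E Phi c Xhat [_ _ c_ge0] [_ Xhat_min] X XPhi|].
  apply: le_trans (OWA_le_aggregated_cost c hw hw_noninc Xhat) _.
  apply: le_trans (Xhat_min X XPhi) _.
  apply: le_trans (aggregated_cost_le hw_noninc hK X c_ge0) _.
  have /andP[w1_ge0 _] := hw.1 (Ordinal hK).
  by rewrite -mulrA ler_wpM2l // sum_cost_le_OWA.
exists (option 'I_K), [set [set None]; tight_opt K], (tight_cost R hK).
exists [set None], (tight_opt K).
rewrite OWA_tight_opt // OWA_tight_hat ltr01 mulr1; split=> //.
- split; [|exact: tight_cost_inj|exact: tight_cost_ge0].
  by apply/set0Pn; exists [set None]; rewrite set21.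
(* The two feasible solutions tie in aggregated cost, so the worse one is also a minimizer. *)
- split=> [|X]; first exact: set21.
  by rewrite aggregated_tight_hat => /set2P[]->;
    rewrite ?aggregated_tight_hat ?aggregated_tight_opt.
- exact: set22.
Qed.
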